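(* Let $p\ge 1$, and suppose that $u_0\in C^0(\mathbb{R}^n)$ is such that there exist $c_0,\alpha,\beta>0$ fulfilling $$u_0(x)\ge c_0\,e^{-\alpha|x|^\beta}\qquad\text{for all }x\in\mathbb{R}^n.$$ Then one can find $t_0>1$ and $C>0$ such that any positive classical solution $u$ of $$u_t=u^p\Delta u\ \ (x\in\mathbb{R}^n,\ t>0),\qquad u(x,0)=u_0(x)\ \ (x\in\mathbb{R}^n)$$ satisfies $$\|u(\cdot,t)\|_{L^\infty(\mathbb{R}^n)}\ge C\,t^{-\frac1p}\,(\ln t)^{\frac{2}{p\beta}}\qquad\text{for all }t\ge t_0.$$
   Context: A positive classical solution is a positive function $u\in C^0(\mathbb{R}^n\times[0,\infty))\cap C^{2,1}(\mathbb{R}^n\times(0,\infty))$ satisfying the equation and the initial condition pointwise. *)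

(* Defs.v *)
From HB Require Import structures.
From mathcomp Require Import all_boot all_order all_algebra.
From mathcomp Require Import all_classical all_reals all_analysis.

Set Implicit Arguments.
Unset Strict Implicit.
Unset Printing Implicit Defensive.

Import Order.TTheory GRing.Theory Num.Theory.
Import numFieldNormedType.Exports.

Local Open Scope classical_set_scope.
Local Open Scope ring_scope.

(* The norm `|x| that the library puts on 'rV[R]_n is the maximum norm; it
   induces the usual topology but is not the Euclidean length. *)
Definition enorm (R : realType) (n : nat) (x : 'rV[R]_n) : R :=
  Num.sqrt (\sum_(i < n) x 0 i ^+ 2).

Section lebesgue_Rn.
Variable R : realType.
Local Notation T := (measurableTypeR R).

Definition consRn (n : nat) (z : T * n.-tuple T) : n.+1.-tuple T :=
  [tuple of z.1 :: z.2].

Lemma measurable_consRn n : measurable_fun setT (@consRn n).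
Proof. exact: (measurable_cons measurable_fst measurable_snd). Qed.

Section cons_measure.
Variables (n : nat) (mu : {sigma_finite_measure set (n.-tuple T) -> \bar R}).

Definition cons_measure : set (n.+1.-tuple T) -> \bar R :=
  pushforward (@lebesgue_measure R \x mu)%E (@consRn n).

Let cons_measure0 : cons_measure set0 = 0%E.
Proof. by rewrite /cons_measure /pushforward preimage_set0 measure0. Qed.

Let cons_measure_ge0 A : (0 <= cons_measure A)%E.
Proof. by rewrite /cons_measure /pushforward measure_ge0. Qed.

Let cons_measure_sigma_additive : semi_sigma_additive cons_measure.
Proof.
move=> F mF tF mUF; rewrite /cons_measure /pushforward preimage_bigcup.
have mp A : measurable A -> measurable (@consRn n @^-1` A).
  by move=> mA; rewrite -[X in measurable X]setTI; exact: measurable_consRn.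
apply: measure_semi_sigma_additive.
- by move=> i; exact: mp.
- apply/trivIsetP => /= i j _ _ ij; rewrite -preimage_setI.
  by move/trivIsetP : tF => /(_ _ _ _ _ ij) ->//; rewrite preimage_set0.
- by rewrite -preimage_bigcup; exact: mp.
Qed.

HB.instance Definition _ := isMeasure.Build _ _ _ cons_measure
  cons_measure0 cons_measure_ge0 cons_measure_sigma_additive.

Let cons_measure_sigma_finite : sigma_finite setT cons_measure.
Proof.
have /sigma_finiteP[F [FT ndF Foo]] := sigma_finiteT (@lebesgue_measure R).
have /sigma_finiteP[G [GT ndG Goo]] := sigma_finiteT mu.
pose g (v : n.+1.-tuple T) : (T * n.-tuple T)%type := (thead v, [tuple of behead v]).
have mg : measurable_fun setT g.
  by apply: measurable_fun_pair; [exact: measurable_tnth|exact: measurable_behead].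
have gK z : g (consRn z) = z.
  case: z => a v; rewrite /g/consRn/= theadE; congr (_, _).
  exact/val_inj.
exists (fun i => g @^-1` (F i `*` G i)).
  rewrite -preimage_bigcup; apply/seteqP; split => // v _ /=.
  have [i _ Fi] : (\bigcup_i F i) (g v).1 by rewrite -FT.
  have [j _ Gj] : (\bigcup_i G i) (g v).2 by rewrite -GT.
  exists (maxn i j) => //; split.
    by move: Fi; exact/subsetPset/ndF/leq_maxl.
  by move: Gj; exact/subsetPset/ndG/leq_maxr.
move=> i; have [mF Fi] := Foo i; have [mG Gi] := Goo i; split.
  by rewrite -[X in measurable X]setTI; apply: mg => //; exact: measurableX.
rewrite /cons_measure /pushforward (_ : _ @^-1` _ = F i `*` G i).
  by rewrite product_measure1E// lte_mul_pinfty// ge0_fin_numE.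
by apply/seteqP; split => z; rewrite /preimage /mkset gK.
Qed.

HB.instance Definition _ :=
  Measure_isSigmaFinite.Build _ _ _ cons_measure cons_measure_sigma_finite.

End cons_measure.

(* Lebesgue measure on the Borel sigma-algebra of R^n: the n-fold product of
   the Lebesgue measure on R (the unit mass at the empty tuple for n = 0). *)
Fixpoint lebesgue_Rn (n : nat) :
    {sigma_finite_measure set (n.-tuple T) -> \bar R} :=
  if n is m.+1 then cons_measure (lebesgue_Rn m)
  else dirac ([tuple] : 0.-tuple T).

End lebesgue_Rn.

(* Essential supremum of |f|; it is +oo when f is essentially unbounded. *)
Definition Linfty_norm (R : realType) (n : nat) (f : 'rV[R]_n -> R) : \bar R :=
  Lnorm (lebesgue_Rn R n) +oo%E
    (fun v : n.-tuple (measurableTypeR R) => (f (\row_(i < n) tnth v i))%:E).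

Section parabolic.
Variables (R : realType) (n : nat).
Implicit Types w : 'rV[R]_n -> R -> R.

Definition dx (i : 'I_n) w : 'rV[R]_n -> R -> R :=
  fun x t => 'D_(delta_mx 0 i) (w ^~ t) x.

Definition dt w : 'rV[R]_n -> R -> R := fun x t => derive1 (w x) t.

Definition laplacian w : 'rV[R]_n -> R -> R :=
  fun x t => \sum_(i < n) dx i (dx i w) x t.

(* w is in C^0(R^n x [0,oo)); the values of w at negative times are junk *)
Definition C0_closed w : Prop :=
  {within [set z : 'rV[R]_n * R | 0 <= z.2], continuous (fun z => w z.1 z.2)}.

Definition C0_open w : Prop :=
  forall z : 'rV[R]_n * R, 0 < z.2 -> {for z, continuous (fun z => w z.1 z.2)}.

(* The derivatives 'D_v and derive1 are total: existence is stated separately. *)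
Definition C21 w : Prop :=
  [/\ C0_open w,
      (forall x t, 0 < t -> derivable (w x) t 1) /\ C0_open (dt w),
      forall i, (forall x t, 0 < t -> derivable (w ^~ t) x (delta_mx 0 i)) /\
                C0_open (dx i w)
    & forall i j,
        (forall x t, 0 < t -> derivable (dx i w ^~ t) x (delta_mx 0 j)) /\
        C0_open (dx j (dx i w)) ].

Definition positive_classical_solution (p : R) (u0 : 'rV[R]_n -> R)
    (u : 'rV[R]_n -> R -> R) : Prop :=
  [/\ forall x t, 0 <= t -> 0 < u x t,
      C0_closed u,
      C21 u,
      forall x t, 0 < t -> dt u x t = u x t `^ p * laplacian u x t
    & forall x, u x 0 = u0 x ].

End parabolic.

(* Main.v *)
(** Put L = (ln t / (2 alpha p))^(1/beta) and K = (2n + 1) / L^2.  The function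
    v(x, s) = (A + p K s)^(-1/p) (1 - |x|^2 / L^2) is a strict subsolution on the
    ball of radius L: its first factor y solves y' = - K y^(1+p), and
    (1 - |x|^2 / L^2)^p <= 1 - |x|^2 / L^2 since p >= 1.  Choosing A so that
    v(x, 0) = (c0 / 2) e^(- alpha L^beta) (1 - |x|^2 / L^2) puts v below u at
    time 0, and comparison gives u(0, t) > v(0, t).  As A is of order t^(1/2),
    hence at most a multiple of t / L^2, v(0, t) is of order (t / L^2)^(-1/p). *)
Require Import Defs.
From mathcomp Require Import all_boot all_order all_algebra.
From mathcomp Require Import all_classical all_reals all_analysis.
From mathcomp Require Import ring lra.
Import Order.TTheory GRing.Theory Num.Theory.
Import numFieldNormedType.Exports.
Local Open Scope classical_set_scope.
Local Open Scope ring_scope.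

(** * Derivative tests at a minimum, in one variable *)

Lemma slope_lt0 (R : realType) (f : R -> R) (c d : R) :
  is_derive c 1 f d -> d < 0 ->
  exists2 e, 0 < e &
    forall h, h != 0 -> `|h| < e -> h^-1 * (f (h + c) - f c) < 0.
Proof.
move=> [df <-] D0.
have [e /= e0 He] := cvgr_lt _ df _ D0.
exists e => // h h0 he.
have := He h; rewrite /ball/= sub0r normrN => /(_ he h0).
by rewrite /= [h%:A](mulr1).
Qed.

(** Only earlier points are compared, because a minimum over a compact time interval may sit at its
    right end. *)
Lemma derive_left_min_le0 (R : realType) (f : R -> R) (c d e : R) :
  is_derive c 1 f d -> 0 < e ->
  (forall s, c - e < s < c -> f c <= f s) -> d <= 0.
Proof.
move=> fd e0 fmin; rewrite leNgt; apply/negP => d0.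
have [|e' e'0 He'] := @slope_lt0 _ (- f) c (- d) _; first by rewrite oppr_lt0.
pose h := Num.min e e' / 2.
have m0 : 0 < Num.min e e' by rewrite lt_min e0.
have h0 : 0 < h by rewrite divr_gt0.
have hm : h < Num.min e e' by rewrite /h; lra.
move: hm; rewrite lt_min => /andP[he he'].
have := He' (- h); rewrite oppr_eq0 gt_eqF// normrN gtr0_norm// => /(_ isT he').
rewrite fctE invrN mulNr oppr_lt0 pmulr_rgt0 ?invr_gt0//.
have := fmin (- h + c); lra.
Qed.

(** At the minimum [df 0 = 0]; if [d2 < 0], then [df] is negative just to the right of 0, and the
    mean value theorem gives [f h < f 0] for a small [h > 0]. *)
Lemma second_derive_min_ge0 (R : realType) (f df : R -> R) (d2 e : R) :
  (forall s : R, is_derive s 1 f (df s)) ->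
  is_derive (0 : R) 1 df d2 -> 0 < e ->
  (forall s, `|s| < e -> f 0 <= f s) -> 0 <= d2.
Proof.
move=> fdf dfd2 e0 fmin; rewrite leNgt; apply/negP => d20.
have df0 : df 0 = 0.
  have f'0 : is_derive (0 : R) 1 f 0.
    apply: (@derive1_at_min _ f (- e) e 0).
    - lra.
    - by move=> s _; have [] := fdf s.
    - by rewrite in_itv/= oppr_lt0 e0.
    - by move=> s; rewrite in_itv/= => se; apply: fmin; rewrite ltr_norml.
  by rewrite -(@derive_val _ _ _ _ _ _ _ (fdf 0)) derive_val.
have [e' e'0 He'] := slope_lt0 _ _ _ _ dfd2 d20.
pose h := Num.min e e' / 2.
have m0 : 0 < Num.min e e' by rewrite lt_min e0.
have h0 : 0 < h by rewrite divr_gt0.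
have hm : h < Num.min e e' by rewrite /h; lra.
move: hm; rewrite lt_min => /andP[he he'].
have fh : f 0 <= f h by apply: fmin; rewrite gtr0_norm.
have cf : {within `[0, h], continuous f}.
  apply: continuous_subspaceT => s; apply/differentiable_continuous.
  by apply/derivable1_diffP; have [] := fdf s.
have [c /[!in_itv]/= /andP[c0 ch] E] := MVT h0 (fun s _ => fdf s) cf.
have := He' c; rewrite gt_eqF// gtr0_norm// df0 addr0 subr0.
move=> /(_ isT (lt_trans ch he')); rewrite pmulr_rlt0 ?invr_gt0// => dc0.
have : df c * (h - 0) < 0 by rewrite subr0 pmulr_llt0.
rewrite -E; lra.
Qed.

(** The difference quotients on both sides coincide, so directional derivatives become accessible to
    the one-variable tests. *)
Lemma is_derive_line (R : realType) (V : normedModType R) (w : V -> R)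
    (x v : V) (s : R) :
  derivable w (s *: v + x) v ->
  is_derive s 1 (fun r : R => w (r *: v + x)) ('D_v w (s *: v + x)).
Proof.
have E : (fun h : R =>
      h^-1 *: (((fun r : R => w (r *: v + x)) \o shift s) (h *: 1) -
        w (s *: v + x))) =
    (fun h : R => h^-1 *: ((w \o shift (s *: v + x)) (h *: v) - w (s *: v + x))).
  by apply/funext => h /=; rewrite [h%:A]mulr1 scalerDl addrA.
by move=> dw; apply: DeriveDef; rewrite /derivable /derive E.
Qed.

(** * Boxes of positive measure and the essential supremum *)

Lemma measurable_box (d : measure_display) (T : measurableType d) (n : nat)
    (A : 'I_n -> set T) :
  (forall i, measurable (A i)) ->
  measurable [set v : n.-tuple T | forall i, A i (tnth v i)].
Proof.
move=> mA.
have -> : [set v : n.-tuple T | forall i, A i (tnth v i)] =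
    \big[setI/setT]_(i < n) ((@tnth n _)^~ i @^-1` A i).
  apply/seteqP; split => v.
    by move=> Bv; elim/big_ind : _ => // i _; exact: Bv.
  by move=> + i; rewrite (bigD1 i)//= => -[].
apply: bigsetI_measurable => i _.
by rewrite -[X in measurable X]setTI; exact: measurable_tnth.
Qed.

(** Induction on the dimension: splitting off the first coordinate turns the box into the product of
    [A ord0] and a box of one dimension less. *)
Lemma lebesgue_Rn_box_gt0 (R : realType) (n : nat)
    (A : 'I_n -> set (measurableTypeR R)) :
  (forall i, measurable (A i)) -> (forall i, (0 < lebesgue_measure (A i))%E) ->
  (0 < lebesgue_Rn R n [set v | forall i, A i (tnth v i)])%E.
Proof.
elim: n A => [|n IH] A mA A0 /=.
  by rewrite diracE mem_set/= ?lte01// => -[].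
rewrite /cons_measure /pushforward.
set B := [set v : n.-tuple (measurableTypeR R) |
  forall i : 'I_n, A (lift ord0 i) (tnth v i)].
have -> : @consRn R n @^-1` [set v | forall i, A i (tnth v i)] = A ord0 `*` B.
  apply/seteqP; split => -[a v] /=.
    move=> H; split; first by have := H ord0; rewrite tnth0.
    by move=> i; have := H (lift ord0 i); rewrite tnthS.
  by move=> [/= Aa Bv] i; case: (unliftP ord0 i) => [j|] ->;
    rewrite ?tnthS ?tnth0.
have mB : measurable B.
  exact (@measurable_box _ (measurableTypeR R) n _ (fun i => mA (lift ord0 i))).
have B0 : (0 < lebesgue_Rn R n B)%E.
  exact (IH _ (fun i => mA (lift ord0 i)) (fun i => A0 (lift ord0 i))).
by rewrite product_measure1E//; apply: mule_gt0 => //; exact: A0.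
Qed.

(** By continuity [f] exceeds [m] on a ball around [x]; balls of the maximum norm are boxes, hence
    not null. *)
Lemma le_Linfty_norm (R : realType) (n : nat) (f : 'rV[R]_n -> R) x m :
  {for x, continuous f} -> m < f x -> (m%:E <= Linfty_norm f)%E.
Proof.
move=> cf mfx.
have [e /= e0 He] := (nbhs_ballP _ _).1 (cvgr_gt _ cf _ mfx).
pose A i : set (measurableTypeR R) := ball (x 0 i) e.
have mA i : measurable (A i) by exact: measurable_realfun.measurable_ball.
pose B := [set v : n.-tuple (measurableTypeR R) | forall i, A i (tnth v i)].
have mB : measurable B by exact (@measurable_box _ (measurableTypeR R) n _ mA).
have B0 : (0 < lebesgue_Rn R n B)%E.
  apply: lebesgue_Rn_box_gt0 => // i.
  by rewrite /A lebesgue_measure_ball ?lte_fin ?mulrn_wgt0// ltW.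
rewrite /Linfty_norm unlock.
(* [Lnorm] at [+oo] is the essential supremum only when the whole space has positive measure, and 0
   otherwise. *)
have -> : (0 < lebesgue_Rn R n [set: n.-tuple (measurableTypeR R)])%E.
  by apply: lt_le_trans B0 _; apply: le_measure; rewrite ?inE.
rewrite leNgt; apply/negP => Em.
(* Off the null set [N], [|f|] is at most the essential supremum, assumed below [m]; so the box
   would lie inside [N]. *)
have [N [mN N0 HN]] := ess_sup_inf.ess_sup_ge (lebesgue_Rn R n)
  (abse \o (fun v : n.-tuple (measurableTypeR R) => (f (\row_i tnth v i))%:E)).
have : (lebesgue_Rn R n B <= 0)%E.
  rewrite -N0; apply: le_measure; rewrite ?inE// => v Bv; apply: HN => /= H.
  have /He : ball x e (\row_i tnth v i).
    by split=> // i j; rewrite ord1 mxE; exact: Bv.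
  move=> /= mf; have := le_lt_trans H Em.
  by rewrite lte_fin; have := ler_norm (f (\row_i tnth v i)); lra.
by rewrite leNgt B0.
Qed.

(** * The time factor and the spatial factor of the barrier *)

Lemma is_derive_power_profile (R : realType) (p A K t : R) :
  0 < p -> 0 < A + p * K * t ->
  is_derive t 1 (fun s => (A + p * K * s) `^ (- (1 / p)))
    (- (K * ((A + p * K * t) `^ (- (1 / p))) `^ (1 + p))).
Proof.
move=> p0 z0.
have dz : is_derive t 1 (fun s => A + p * K * s) (p * K).
  by apply: is_derive_eq; rewrite add0r mul1r [_%:A]mulr1.
have := @is_derive1_comp R ((@powR R)^~ (- (1 / p)))
  (fun s => A + p * K * s) t _ _
  (is_derive1_powR (- (1 / p)) z0) dz.
congr is_derive; rewrite -powRrM.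
have -> : - (1 / p) * (1 + p) = - (1 / p) - 1 by field; rewrite gt_eqF.
by field; rewrite gt_eqF.
Qed.

(** Applied to the spatial factor, this reduces the power produced by [u ^ p] to the linear factor
    in the time derivative of the barrier. *)
Lemma powR_le_id (R : realType) (a p : R) : 0 < a <= 1 -> 1 <= p -> a `^ p <= a.
Proof.
move=> a01 p1; rewrite -[leRHS]powRr1; last by case/andP: a01 => /ltW.
exact: ger_powR.
Qed.

Lemma continuous_sqnorm (R : realType) (n : nat) :
  continuous (fun x : 'rV[R]_n => \sum_(i < n) x 0 i ^+ 2).
Proof.
apply: continuous_big => [|i _ x]; first exact: add_continuous.
have cx : {for x, continuous (fun y : 'rV[R]_n => y 0 i)}.
  exact: coord_continuous.
by under eq_fun do rewrite expr2; exact: (cvgM cx cx).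
Qed.

Lemma sqnorm_line (R : realType) (n : nat) (x : 'rV[R]_n) (i : 'I_n) (s : R) :
  \sum_(j < n) (s *: delta_mx 0 i + x) 0 j ^+ 2 =
  \sum_(j < n) x 0 j ^+ 2 + (2 * s * x 0 i + s ^+ 2).
Proof.
rewrite (bigD1 i)//= [in RHS](bigD1 i)//= !mxE !eqxx/=.
under eq_bigr => j ji do rewrite !mxE eqxx (negbTE ji)/= mulr0 add0r.
by ring.
Qed.

(** * Comparison of the solution with the barrier *)

Section barrier.
Variables (R : realType) (n : nat) (p A K L : R) (u0 : 'rV[R]_n -> R).
Variable u : 'rV[R]_n -> R -> R.
Hypotheses (p1 : 1 <= p) (A0 : 0 < A) (L0 : 0 < L).
Hypothesis K_gt : 2 * n%:R / L ^+ 2 < K.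
Hypothesis usol : positive_classical_solution p u0 u.

Let q (x : 'rV[R]_n) := \sum_(i < n) x 0 i ^+ 2.
Let phi x := 1 - q x / L ^+ 2.
Let y t := (A + p * K * t) `^ (- (1 / p)).

Hypothesis u0_gt : forall x, y 0 * phi x < u0 x.

Let p0 : 0 < p. Proof. exact: lt_le_trans p1. Qed.

Let K0 : 0 < K.
Proof.
apply: le_lt_trans K_gt.
by apply: divr_ge0; [exact: mulr_ge0|exact: sqr_ge0].
Qed.

Let base_gt0 (t : R) : 0 <= t -> 0 < A + p * K * t.
Proof. by move=> t0; rewrite ltr_wpDr// !mulr_ge0// ltW. Qed.

Let y_gt0 (t : R) : 0 <= t -> 0 < y t.
Proof. by move=> /base_gt0 /powR_gt0; exact. Qed.

Let is_derive_y (t : R) : 0 <= t -> is_derive t 1 y (- (K * y t `^ (1 + p))).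
Proof. by move=> t0; apply: is_derive_power_profile => //; exact: base_gt0. Qed.

Let continuous_barrier (T : R) :
  {within [set v : 'rV[R]_n | forall i, `[- L, L]%classic (v ord0 i)]
     `*` `[0, T]%classic,
    continuous (fun z => u z.1 z.2 - y z.2 * phi z.1)}.
Proof.
have [_ cu _ _ _] := usol; set Q := _ `*` _.
(* At time 0 the solution is continuous only relative to nonnegative times. *)
have {}cu : {within Q, continuous (fun z => u z.1 z.2)}.
  apply: continuous_subspaceW cu => -[v t] [_] /=.
  by rewrite in_itv/= => /andP[].
have cb : {within Q, continuous (fun z => y z.2 * phi z.1)}.
  apply: continuous_in_subspaceT => z /set_mem[_ /=].
  rewrite in_itv/= => /andP[z0 _].
  have cy : {for z.2, continuous y}.
    apply/differentiable_continuous/derivable1_diffP.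
    by have [] := is_derive_y _ z0.
  have cphi : {for z.1, continuous phi}.
    have cq : {for z.1, continuous (fun x : 'rV[R]_n => q x / L ^+ 2)}.
      exact: (continuousM (continuous_sqnorm _ _ z.1)
        (@cst_continuous _ _ _ _)).
    have c1 : {for z.1, continuous (fun _ : 'rV[R]_n => 1 : R)}
      by exact: cst_continuous.
    exact: (continuousB c1 cq).
  have cy' : {for z, continuous (fun z : 'rV[R]_n * R => y z.2)}.
    by apply: (continuous_comp (f := snd)); [exact: cvg_snd|exact: cy].
  have cphi' : {for z, continuous (fun z : 'rV[R]_n * R => phi z.1)}.
    by apply: (continuous_comp (f := fst)); [exact: cvg_fst|exact: cphi].
  exact: (continuousM cy' cphi').
by move=> z; exact: (cvgB (cu z) (cb z)).
Qed.

Let touching_time x (t : R) : 0 < t ->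
  (forall s, 0 < s < t -> u x t - y t * phi x <= u x s - y s * phi x) ->
  dt u x t <= - (K * y t `^ (1 + p)) * phi x.
Proof.
move=> t0 tmin; have [_ _ [_ [du _] _ _] _ _] := usol.
have fd : is_derive t 1 (fun s => u x s - y s * phi x)
    (dt u x t - (- (K * y t `^ (1 + p)) * phi x)).
  have d1 : is_derive t 1 (u x) (dt u x t).
    by rewrite /dt derive1E; apply: derivableP; exact: du.
  have d2 := is_derive_y _ (ltW t0).
  by apply: is_derive_eq; rewrite scaler0 add0r [_ *: _]mulrC.
rewrite -subr_le0; apply: (derive_left_min_le0 _ _ _ _ _ fd t0) => s.
by rewrite subrr; exact: tmin.
Qed.

(** Second-derivative test along the axis [i]; the lower bound is the second derivative of the
    barrier in that direction. *)
Let touching_space x (t : R) i (e : R) : 0 < t -> 0 < e ->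
  (forall s, `|s| < e -> u x t - y t * phi x <=
     u (s *: delta_mx 0 i + x) t - y t * phi (s *: delta_mx 0 i + x)) ->
  - (2 * y t / L ^+ 2) <= dx i (dx i u) x t.
Proof.
move=> t0 e0 smin; have [_ _ [_ _ C1 C2] _ _] := usol.
pose a := y t / L ^+ 2.
(* By [sqnorm_line], [f] differs by a constant from the solution minus the barrier along the
   line. *)
pose f (s : R) := u (s *: delta_mx 0 i + x) t + a * (2 * s * x 0 i + s ^+ 2).
pose df (s : R) := dx i u (s *: delta_mx 0 i + x) t + a * (2 * x 0 i + 2 * s).
have fd (s : R) : is_derive s 1 f (df s).
  have d := is_derive_line _ _ _ _ _ s ((C1 i).1 (s *: delta_mx 0 i + x) t t0).
  by apply: is_derive_eq; rewrite /df /dx /GRing.scale/=; ring.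
have dfd : is_derive (0 : R) 1 df (dx i (dx i u) x t + 2 * a).
  have := is_derive_line _ _ _ _ _ 0 ((C2 i i).1 (0 *: delta_mx 0 i + x) t t0).
  rewrite scale0r add0r => d.
  by apply: is_derive_eq; rewrite /dx /GRing.scale/=; ring.
rewrite -subr_ge0 opprK -mulrA.
apply: (second_derive_min_ge0 _ _ _ _ _ fd dfd e0).
move=> s /smin; rewrite /f scale0r add0r /phi /q sqnorm_line /a.
have : L != 0 by rewrite gt_eqF.
lra.
Qed.

(* At a nonpositive minimum of u - v one has u <= v, and the Laplacian of v is
   negative, so that u^p times the Laplacian of u is at least v^p times that of
   v: no first touching time is needed. *)
Lemma barrier_lt x (t : R) : 0 <= t -> y t * phi x < u x t.
Proof.
move=> t0; rewrite ltNge; apply/negP => uy.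
have [upos _ _ ueq uini] := usol.
(* As [u] is positive, any point where it does not exceed the barrier lies in the open ball of
   radius [L]; a nonpositive minimum therefore avoids the lateral boundary. *)
have phi_gt0 x' (t' : R) : 0 <= t' -> u x' t' <= y t' * phi x' -> 0 < phi x'.
  by move=> t'0 /(lt_le_trans (upos x' _ t'0)); rewrite pmulr_rgt0// y_gt0.
have L20 : 0 < L ^+ 2 by rewrite exprn_gt0.
have phi_lt x' i : 0 < phi x' -> `|x' 0 i| < L.
  rewrite subr_gt0 ltr_pdivrMr// mul1r => /(le_lt_trans _) qL.
  rewrite -ltr_sqr ?nnegrE ?normr_ge0 ?ltW// real_normK ?num_real//; apply: qL.
  by rewrite /q (bigD1 i)//= lerDl sumr_ge0// => j _; exact: sqr_ge0.
(* The cube contains the ball and is compact as a product of segments. *)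
set Q := [set v : 'rV[R]_n | forall i, `[- L, L]%classic (v ord0 i)]
  `*` `[0, t]%classic.
have cQ : compact Q.
  exact: (compact_setX (rV_compact (fun i => @segment_compact R (- L) L))
    (@segment_compact R 0 t)).
have Qxt : Q (x, t).
  split => /= [i|]; last by rewrite in_itv/= t0 lexx.
  by rewrite in_itv/= -ler_norml ltW// phi_lt// (phi_gt0 _ t).
have [[x1 t1] /set_mem Qc cmin] :=
  compact_EVT_min (ex_intro _ _ Qxt) cQ (continuous_barrier t).
have [Qx1 /= /[!in_itv]/= /andP[t10 t1t]] := Qc.
have uy1 : u x1 t1 <= y t1 * phi x1.
  rewrite -subr_le0; apply: le_trans (cmin _ (mem_set Qxt)) _.
  by rewrite subr_le0.
have phi1 : 0 < phi x1 by exact: phi_gt0 uy1.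
have phi_le1 : phi x1 <= 1.
  rewrite gerBl; apply: divr_ge0; last exact: ltW.
  by apply: sumr_ge0 => j _; exact: sqr_ge0.
have {t10} t1_gt0 : 0 < t1.
  rewrite lt_neqAle t10 andbT; apply/eqP => t1E; move: uy1.
  by rewrite -t1E uini leNgt u0_gt.
have Dt : dt u x1 t1 <= - (K * y t1 `^ (1 + p)) * phi x1.
  apply: touching_time => // s /andP[s0 st].
  apply: (cmin (x1, s)); apply: mem_set; split => //=.
  by rewrite in_itv/= ltW//= (le_trans (ltW st)).
(* Moving along the axis [i] by less than [L - |x1 0 i|] stays inside the cube, where [(x1, t1)] is
   minimal. *)
have Dx i : - (2 * y t1 / L ^+ 2) <= dx i (dx i u) x1 t1.
  apply: (@touching_space _ _ _ (L - `|x1 0 i|)) => //.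
    by rewrite subr_gt0 phi_lt.
  move=> s sL; apply: (cmin (_, t1)); apply: mem_set; split => //=; last first.
    by rewrite in_itv/= ltW.
  move=> j; rewrite !mxE eqxx/=; have [->|ji] := eqVneq j i.
    rewrite mulr1 in_itv/= -ler_norml (le_trans (ler_normD _ _))//.
    by rewrite -lerBrDr ltW.
  by rewrite mulr0 add0r; exact: Qx1.
have Dlap : - (2 * n%:R / L ^+ 2 * y t1) <= laplacian u x1 t1.
  have -> : - (2 * n%:R / L ^+ 2 * y t1) = \sum_(i < n) - (2 * y t1 / L ^+ 2).
    by rewrite sumr_const card_ord -mulr_natr; lra.
  exact: ler_sum.
have yt1 := y_gt0 _ (ltW t1_gt0).
have up0 : 0 <= u x1 t1 `^ p by exact: powR_ge0.
have up : u x1 t1 `^ p <= y t1 `^ p * phi x1.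
  apply: (@le_trans _ _ ((y t1 * phi x1) `^ p)).
    apply: (ge0_ler_powR (ltW p0) _ _ uy1); rewrite nnegrE ltW//.
      by apply: upos; exact: ltW.
    exact: mulr_gt0.
  by rewrite (powRM _ (ltW yt1) (ltW phi1)) ler_wpM2l ?powR_ge0//
    powR_le_id// phi1.
have yp0 : 0 < y t1 `^ p by exact: powR_gt0.
have yE : y t1 `^ (1 + p) = y t1 * y t1 `^ p.
  by rewrite powRD ?powRr1 ?ltW//; apply/implyP => _; rewrite gt_eqF.
move: Dt; rewrite ueq// yE leNgt => /negP; apply.
(* The lower bound for the Laplacian is nonpositive, so it combines with the upper bound [up]; the
   strict gap in [K_gt] then contradicts [touching_time]. *)
apply: (@lt_le_trans _ _ (u x1 t1 `^ p * - (2 * n%:R / L ^+ 2 * y t1))).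
  rewrite mulrN mulNr ltrN2.
  apply: (@le_lt_trans _ _ (y t1 `^ p * phi x1 * (2 * n%:R / L ^+ 2 * y t1))).
    apply: ler_wpM2r up; apply: mulr_ge0; last exact: ltW.
    by apply: divr_ge0; [exact: mulr_ge0|exact: ltW].
  have := mulr_gt0 (mulr_gt0 yt1 yp0) phi1; set w := _ * _ * phi x1 => w0.
  have := K_gt; rewrite -(ltr_pM2r w0) /w.
  lra.
exact: ler_wpM2l.
Qed.

End barrier.

(** * Growth of the logarithm and comparison at the initial time *)

Lemma powRVl (R : realType) (x r : R) : 0 <= x -> x^-1 `^ r = x `^ (- r).
Proof. by move=> x0; rewrite -powR_inv1// -powRrM mulN1r. Qed.

(** The bound ln z < z is used at z = t^(1/(2a)) and then raised to the power [a]. *)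
Lemma ln_powR_le (R : realType) (a t : R) : 0 < a -> 1 <= t ->
  ln t `^ a <= (2 * a) `^ a * t `^ (1 / 2).
Proof.
move=> a0 t1; have t0 : 0 < t by exact: lt_le_trans t1.
have b0 : 0 < 2 * a by exact: mulr_gt0.
have tb : 0 < t `^ (1 / (2 * a)) by exact: powR_gt0.
have le1 : ln t <= 2 * a * t `^ (1 / (2 * a)).
  have -> : ln t = 2 * a * ln (t `^ (1 / (2 * a))).
    by rewrite ln_powR; field; rewrite gt_eqF.
  by rewrite ler_pM2l// ltW// ln_sublinear.
have -> : t `^ (1 / 2) = (t `^ (1 / (2 * a))) `^ a.
  by rewrite -powRrM; congr (_ `^ _); field; rewrite gt_eqF.
rewrite -powRM; [|exact: ltW|exact: ltW].
apply: (ge0_ler_powR (ltW a0) _ _ le1); rewrite nnegrE.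
  exact: ln_ge0.
by rewrite ltW// mulr_gt0.
Qed.

Lemma continuous_slice (R : realType) (n : nat) (u : 'rV[R]_n -> R -> R) t x :
  C0_open u -> 0 < t -> {for x, continuous (u ^~ t)}.
Proof.
move=> cu t0; apply: (@continuous_comp _ _ _ (fun x : 'rV[R]_n => (x, t))
  (fun z : 'rV[R]_n * R => u z.1 z.2)); last exact: cu.
exact: (@cvg_pair _ _ _ (nbhs x) (nbhs x) (nbhs t) _ _ _ id (cst t) cvg_id
  (@cst_continuous _ _ t x)).
Qed.

Lemma enorm_sqr (R : realType) (n : nat) (x : 'rV[R]_n) :
  enorm x ^+ 2 = \sum_(i < n) x 0 i ^+ 2.
Proof. by rewrite sqr_sqrtr// sumr_ge0// => i _; exact: sqr_ge0. Qed.

(** Where the spatial factor is nonpositive there is nothing to compare; elsewhere [enorm x <= L]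
    bounds the exponential from below, and the factor 1/2 makes the inequality strict. *)
Lemma barrier_initial_lt (R : realType) (n : nat) (c0 alpha beta L : R)
    (x : 'rV[R]_n) : 0 < c0 -> 0 < alpha -> 0 < beta -> 0 < L ->
  c0 / 2 * expR (- (alpha * L `^ beta)) *
    (1 - (\sum_(i < n) x 0 i ^+ 2) / L ^+ 2) <
  c0 * expR (- (alpha * enorm x `^ beta)).
Proof.
move=> c00 a0 b0 L0; have L20 : 0 < L ^+ 2 by rewrite exprn_gt0.
have y0 : 0 < c0 / 2 * expR (- (alpha * L `^ beta)).
  by rewrite mulr_gt0 ?expR_gt0 ?divr_gt0.
have [phi0|phi0] := leP (1 - (\sum_(i < n) x 0 i ^+ 2) / L ^+ 2) 0.
  apply: (@le_lt_trans _ _ 0); first by rewrite pmulr_rle0.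
  by rewrite mulr_gt0 ?expR_gt0.
have phi1 : 1 - (\sum_(i < n) x 0 i ^+ 2) / L ^+ 2 <= 1.
  rewrite gerBl; apply: divr_ge0; last exact: ltW.
  by apply: sumr_ge0 => j _; exact: sqr_ge0.
have xL : enorm x <= L.
  move: phi0; rewrite subr_gt0 ltr_pdivrMr// mul1r -enorm_sqr.
  by rewrite ltr_pXn2r ?nnegrE ?sqrtr_ge0 ?(ltW L0)// => /ltW.
have xLb : alpha * enorm x `^ beta <= alpha * L `^ beta.
  rewrite ler_pM2l//; apply: (ge0_ler_powR (ltW b0) _ _ xL); rewrite nnegrE.
    exact: sqrtr_ge0.
  exact: ltW.
have xLe : expR (- (alpha * L `^ beta)) <= expR (- (alpha * enorm x `^ beta)).
  by rewrite ler_expR lerN2.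
apply: (@le_lt_trans _ _ (c0 / 2 * expR (- (alpha * L `^ beta)))).
  by rewrite ler_piMr// ltW.
apply: (@lt_le_trans _ _ (c0 * expR (- (alpha * L `^ beta)))).
  by rewrite ltr_pM2r ?expR_gt0//; lra.
by rewrite ler_pM2l.
Qed.

(** * Choice of the constants and the final estimate *)

Theorem corollary1p7 (R : realType) (n : nat) (hn : (0 < n)%N)
    (p : R) (hp : 1 <= p)
    (u0 : 'rV[R]_n -> R) (hu0 : continuous u0)
    (c0 alpha beta : R) (hc0 : 0 < c0) (halpha : 0 < alpha) (hbeta : 0 < beta)
    (hlow : forall x : 'rV[R]_n,
      c0 * expR (- (alpha * enorm x `^ beta)) <= u0 x) :
  exists t0 C : R, [/\ 1 < t0, 0 < C &
    forall u : 'rV[R]_n -> R -> R,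
      positive_classical_solution p u0 u ->
      forall t : R, t0 <= t ->
        ((C * t `^ (- (1 / p)) * ln t `^ (2 / (p * beta)))%:E
           <= Linfty_norm (u ^~ t))%E ].
Proof.
have p0 : 0 < p by exact: lt_le_trans hp.
(* With this [s], alpha L^beta = ln t / (2p), so the initial height of the barrier is (c0/2)
   t^(-1/(2p)), decaying more slowly than t^(-1/p). *)
pose s := 2 * alpha * p.
have s0 : 0 < s by rewrite !mulr_gt0.
pose a := 2 / beta.
have a0 : 0 < a by rewrite divr_gt0.
(* [M] makes A = M t^(1/2) match that height, [N] is the constant in L^2 <= N t^(1/2), and [G] will
   bound (A + p K t) L^2 / t. *)
pose M := (c0 / 2) `^ (- p).
have M0 : 0 < M by rewrite powR_gt0// divr_gt0.
pose N := s `^ (- a) * (2 * a) `^ a.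
have N0 : 0 < N by apply: mulr_gt0; apply: powR_gt0 => //; exact: mulr_gt0.
pose G := M * N + p * (2 * n%:R + 1).
have n0 : 0 <= n%:R :> R by [].
have G0 : 0 < G.
  by apply: addr_gt0; apply: mulr_gt0 => //;
    apply: ltr_wpDl => //; exact: mulr_ge0.
(* Only t > 1 is used below, so that ln t > 0. *)
exists 2, (G `^ (- (1 / p)) * s `^ (- (2 / (p * beta)))); split.
- by rewrite ltr1n.
- by rewrite mulr_gt0 ?powR_gt0.
move=> u usol t t2.
have t1 : 1 < t by apply: lt_le_trans t2; rewrite ltr1n.
have t0 : 0 < t by exact: lt_trans t1.
have l0 : 0 < ln t by exact: ln_gt0.
have ls0 : 0 < ln t / s by rewrite divr_gt0.
pose L := (ln t / s) `^ (1 / beta).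
have L0 : 0 < L by rewrite powR_gt0.
have L2E : L ^+ 2 = (ln t / s) `^ a.
  rewrite -powR_mulrn ?ltW// -powRrM; congr (_ `^ _).
  by rewrite /a; field; rewrite gt_eqF.
have L20 : 0 < L ^+ 2 by rewrite exprn_gt0.
have LbE : alpha * L `^ beta = ln t / (2 * p).
  rewrite -powRrM (_ : 1 / beta * beta = 1); last by field; rewrite gt_eqF.
  by rewrite powRr1 ?ltW// /s; field; rewrite !gt_eqF.
pose A := M * t `^ (1 / 2).
have A0 : 0 < A by apply: mulr_gt0 => //; exact: powR_gt0.
pose K := (2 * n%:R + 1) / L ^+ 2.
have K_gt : 2 * n%:R / L ^+ 2 < K by rewrite /K ltr_pM2r ?invr_gt0// ltrDl.
have K0 : 0 < K.
  by apply: divr_gt0 => //; apply: ltr_wpDl => //; exact: mulr_ge0.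
have AE : A `^ (- (1 / p)) = c0 / 2 * expR (- (alpha * L `^ beta)).
  rewrite LbE /A /M powRM ?powR_ge0// -!powRrM.
  rewrite (_ : - p * - (1 / p) = 1); last by field; rewrite gt_eqF.
  rewrite powRr1 ?divr_ge0 ?ltW//; congr (_ * _).
  by rewrite /powR gt_eqF//; congr expR; field; rewrite gt_eqF.
have u0_gt (x : 'rV[R]_n) : (A + p * K * 0) `^ (- (1 / p)) *
    (1 - (\sum_(i < n) x 0 i ^+ 2) / L ^+ 2) < u0 x.
  rewrite mulr0 addr0 AE; apply: lt_le_trans (hlow x).
  exact: barrier_initial_lt.
(* The barrier is tailored to this single [t] and evaluated at the centre of the ball, where its
   spatial factor is 1. *)
have := barrier_lt _ _ _ _ _ _ _ _ hp A0 L0 K_gt usol u0_gt 0 _ (ltW t0).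
rewrite big1; last by move=> i _; rewrite mxE expr0n.
rewrite mul0r subr0 mulr1 => yu.
have [_ _ [cu _ _ _] _ _] := usol.
apply: le_Linfty_norm; first exact: continuous_slice cu t0.
apply: le_lt_trans yu.
have tE : t = t `^ (1 / 2) * t `^ (1 / 2).
  by rewrite -powRD ?gt_eqF ?implybT// -splitr powRr1// ltW.
have L2_le : L ^+ 2 <= N * t `^ (1 / 2).
  rewrite L2E /N powRM ?powRVl ?invr_ge0; [|exact: ltW..].
  by rewrite mulrC -mulrA ler_pM2l ?powR_gt0// ln_powR_le// ltW.
(* A L^2 <= M N t because each of [A] and L^2 contributes t^(1/2); the other term of [G] is exactly
   p K L^2. *)
have base_le : A + p * K * t <= G * t / L ^+ 2.
  rewrite /G mulrDl mulrDl lerD//; last by rewrite /K; lra.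
  rewrite ler_pdivlMr// (_ : M * N * t = A * (N * t `^ (1 / 2))) ?ler_pM2l//.
  by rewrite [in LHS]tE /A; ring.
have base_gt0 : 0 < A + p * K * t.
  by apply: addr_gt0 => //; apply: mulr_gt0 => //; exact: mulr_gt0.
have GtL : 0 < G * t / L ^+ 2 by exact: lt_le_trans base_le.
have pow_le : (G * t / L ^+ 2) `^ (- (1 / p)) <= (A + p * K * t) `^ (- (1 / p)).
  rewrite !powRN lef_pV2 ?posrE ?powR_gt0//.
  apply: (ge0_ler_powR _ _ _ base_le); rewrite ?nnegrE; [|exact: ltW..].
  by rewrite divr_ge0// ltW.
apply: le_trans pow_le.
have Li0 : 0 <= (L ^+ 2)^-1 by rewrite invr_ge0 ltW.
have si0 : 0 <= s^-1 by rewrite invr_ge0 ltW.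
have abp : a * (1 / p) = 2 / (p * beta) by rewrite /a; field; rewrite !gt_eqF.
(* The negative power sends L^2 to (ln t / s)^(2/(p beta)), which yields the logarithm and the power
   of [s] in the constant. *)
rewrite (powRM _ (ltW (mulr_gt0 G0 t0)) Li0) (powRM _ (ltW G0) (ltW t0)).
rewrite (powRVl _ _ _ (ltW L20)) opprK L2E -powRrM abp.
rewrite (powRM _ (ltW l0) si0) (powRVl _ _ _ (ltW s0)).
lra.
Qed.
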